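(* Let $s,t\geq 1$ be integers and let $p,q,l$ be three distinct primes with $p,q$ odd, $p\equiv 3 \pmod 4$, $\mathrm{ord}_{p^s}(l)=\phi(p^s)/2$, $\mathrm{ord}_{q^t}(l)=\phi(q^t)$ and $\gcd(\phi(p^s),\phi(q^t))=2$. Let $0\leq i\leq s-1$ and $0\leq j\leq t-1$. Then in the ring $\mathbb{F}_l[x]/\langle x^{p^sq^t}-1\rangle$: (i) If $q$ is a quadratic residue modulo $p$, then \[ \begin{aligned}\chi_{ij}^2=&\frac{p-3}{4}p^{s-i-1}\Big((q-2)q^{t-j-1}\chi_{ij}+\phi(q^{t-j})\sum_{j<m\leq t}\chi_{im}\Big)\\&+\frac{p+1}{4}p^{s-i-1}\Big((q-2)q^{t-j-1}\chi_{ij}^*+\phi(q^{t-j})\sum_{j<m\leq t}\chi_{im}^*\Big). \end{aligned}\] (ii) If $q$ is a quadratic nonresidue modulo $p$, then \[ \begin{aligned}\chi_{ij}^2=&\frac{p-3}{4}p^{s-i-1}\Big((q-2)q^{t-j-1}\chi_{ij}+\phi(q^{t-j})\Big(\sum_{\substack{j<m\leq t\\2\nmid m-j}}\chi_{im}^*+\sum_{\substack{j<m\leq t\\2\mid m-j}}\chi_{im}\Big)\Big)\\ &+\frac{p+1}{4}p^{s-i-1}\Big((q-2)q^{t-j-1}\chi_{ij}^*+\phi(q^{t-j})\Big(\sum_{\substack{j<m\leq t\\2\nmid m-j}}\chi_{im}+\sum_{\substack{j<m\leq t\\2\mid m-j}}\chi_{im}^*\Big)\Big). \end{aligned}\]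
   Context: Here $\phi$ is Euler's phi function (with $\phi(1)=1$) and $\mathrm{ord}_m(k)$ is the multiplicative order of $k$ modulo $m$. Put $n=p^sq^t$. Fix an integer $g$ that is a primitive root both modulo $p^s$ and modulo $q^t$. For an integer $\gamma$, $C_\gamma=\{\gamma l^r \bmod n: r\geq 0\}\subseteq \mathbb{Z}_n$ is the $l$-cyclotomic coset modulo $n$ containing $\gamma$. For $0\leq i\leq s$, $0\leq j\leq t$ set $C_{ij}=C_{p^iq^j}$ and $C_{ij}^*=C_{p^iq^jg}$; in particular $C_{sj}=C_{sj}^*$ and $C_{st}=C_0=\{0\}$. Define elements of $\mathbb{F}_l[x]/\langle x^{n}-1\rangle$ by $\chi_{ij}=\sum_{\alpha\in C_{ij}}x^\alpha$ and $\chi_{ij}^*=\sum_{\alpha\in C_{ij}^*}x^\alpha$; in particular $\chi_{sj}=\chi_{sj}^*$ and $\chi_{st}=1$. Integer coefficients are read in $\mathbb{F}_l$, and empty sums are $0$. *)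

(* Defs.v *)
From HB Require Import structures.
From mathcomp Require Import all_boot all_order all_fingroup all_algebra.

Set Implicit Arguments.
Unset Strict Implicit.
Unset Printing Implicit Defensive.

Import GRing.Theory.
Local Open Scope ring_scope.

(* The order of the class of k in the unit group of Z/m, for 1 < m; the value
   0 when k is not invertible modulo m is never an order. *)
Definition ord_mod (m : nat) (k : int) : nat :=
  if (insub (k%:~R : 'Z_m) : option {unit 'Z_m}) is Some u then #[u]%g else 0%N.

Definition primitive_root_mod (m : nat) (g : int) : Prop :=
  ord_mod m g = totient m.

Definition quadratic_residue (p a : nat) : Prop :=
  coprime a p /\ exists x : nat, (x ^ 2 = a %[mod p])%N.

Definition quadratic_nonresidue (p a : nat) : Prop :=
  coprime a p /\ ~ (exists x : nat, (x ^ 2 = a %[mod p])%N).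

Definition cyclotomic_coset (n l : nat) (gamma : int) : {set 'Z_n} :=
  [set a : 'Z_n | fconnect (fun b : 'Z_n => b * l%:R) gamma%:~R a].

Lemma mem_cyclotomic_coset n l gamma (a : 'Z_n) :
  a \in cyclotomic_coset n l gamma <->
  exists r : nat, a = (gamma * l%:Z ^+ r)%:~R.
Proof.
have iterE r : iter r (fun b : 'Z_n => b * l%:R) gamma%:~R
    = (gamma * l%:Z ^+ r)%:~R.
  rewrite intrM rmorphXn /= pmulrn; elim: r => [|r IHr]; first by rewrite mulr1.
  by rewrite iterS IHr exprSr mulrA.
rewrite inE; split=> [/iter_findex <- | [r ->]].
  by eexists; exact: iterE.
by rewrite -iterE; exact: fconnect_iter.
Qed.

(* F_l[x]/<x^n - 1>, for l prime and 0 < n. *)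
Notation cyclic_ring n l := {poly %/ ('X^n - 1 : {poly 'F_l})}.

(* {poly %/ h} is the quotient by mk_monic h, which is h itself here. *)
Lemma mk_monic_Xn_sub1 n l : (0 < n)%N ->
  mk_monic ('X^n - 1 : {poly 'F_l}) = 'X^n - 1.
Proof.
move=> n_gt0.
by rewrite /mk_monic size_XnsubC // ltnS n_gt0 monicXnsubC.
Qed.

Definition coset_sum (n l : nat) (gamma : int) : cyclic_ring n l :=
  \sum_(alpha in cyclotomic_coset n l gamma) 'qX ^+ (alpha : nat).

Definition chi (p q s t l i j : nat) : cyclic_ring (p ^ s * q ^ t)%N l :=
  coset_sum (p ^ s * q ^ t) l (p ^ i * q ^ j)%N.

(* The starred sums, for a common primitive root g modulo p ^ s and q ^ t. *)
Definition chi_star (g : int) (p q s t l i j : nat) :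
    cyclic_ring (p ^ s * q ^ t)%N l :=
  coset_sum (p ^ s * q ^ t) l ((p ^ i * q ^ j)%N%:Z * g).

(* Main.v *)
(* Put P = p ^ s, Q = q ^ t and let y be the class of 'X, so y ^ (P Q) = 1.
   Writing residues modulo P Q as Q a + P b, the coset of p ^ i q ^ j c becomes
   a full product: a = p ^ i u with u in a fixed class modulo the squares, and
   b = q ^ j v with v a unit; this is where the orders of l and their
   coprimality enter.  Its sum therefore factors as class_sum * unit_sum, the
   class being that of c q ^ (t + j).  A class sum at level p ^ k.+1 is the
   corresponding sum over F_p times a geometric sum over the multiples of p, so
   squaring it amounts to counting representations as sums of two elements of a
   class in F_p, which is elementary since -1 is a nonsquare.  A unit sum is the
   difference of two geometric sums, which gives its square, and a geometric
   sum splits along q-adic valuations into the unit sums of all levels.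
   Classes of 'F_p modulo squares are encoded by x ^ ((p - 1) / 2) in {1, -1}. *)

Require Import Defs.
From HB Require Import structures.
From mathcomp Require Import all_boot all_order all_fingroup all_algebra.
From mathcomp Require Import cyclic zify ring.
Import GRing.Theory.
Local Open Scope ring_scope.

(** * Geometric sums over residues and over units modulo a prime power *)

Section GeometricSums.

Variable R : comNzRingType.
Implicit Types (w : R) (F : pred nat).

Definition geom w (k : nat) : R := \sum_(0 <= x < k) w ^+ x.

(** Multiplication by [w] permutes the summands cyclically: splitting off the first or the last of
    the terms [w ^+ x] with [x < k.+1] removes 1 in both cases. *)
Lemma mul_geom w k a : w ^+ k = 1 -> w ^+ a * geom w k = geom w k.
Proof.
move=> wk; elim: a => [|a IHa]; first by rewrite mul1r.
rewrite exprSr -mulrA -[RHS]IHa; congr (_ * _); rewrite /geom big_distrr /=.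
under eq_bigr do rewrite -exprS.
have: \sum_(0 <= x < k.+1) w ^+ x = \sum_(0 <= x < k) w ^+ x + 1.
  by rewrite big_nat_recr //= wk.
by rewrite big_nat_recl //= expr0 addrC => /addIr.
Qed.

Lemma geom_mul_geom w k F m : w ^+ k = 1 ->
  (\sum_(0 <= x < m | F x) w ^+ x) * geom w k
    = geom w k *+ \sum_(0 <= x < m | F x) 1.
Proof.
move=> wk; rewrite big_distrl /= -sumrMnr.
by apply: eq_bigr => x _; exact: mul_geom.
Qed.

Lemma geom_sqr w k : w ^+ k = 1 -> geom w k ^+ 2 = geom w k *+ k.
Proof.
move=> wk; rewrite expr2 {1}/geom geom_mul_geom // sum1_count.
by rewrite count_predT size_iota subn0.
Qed.

(** With x = a + m b and a < m, the condition sees only a, while b runs freely. *)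
Lemma sum_mod_blocks w F m k :
  \sum_(0 <= x < m * k | F (x %% m)%N) w ^+ x
    = (\sum_(0 <= a < m | F a) w ^+ a) * geom (w ^+ m) k.
Proof.
elim: k => [|k IHk]; first by rewrite muln0 /geom !big_nil mulr0.
rewrite mulnS addnC (@big_cat_nat _ _ _ (m * k)) ?leq_addr //= IHk.
rewrite /geom big_nat_recr //= mulrDr; congr (_ + _).
rewrite -{1}[(m * k)%N]add0n [(m * k + m)%N]addnC big_addn addnK.
rewrite big_distrl /= [LHS]big_nat_cond [RHS]big_nat_cond; apply: eq_big => x.
  by apply: andb_id2l => /= lt_xm; rewrite addnC mulnC modnMDl modn_small.
by move=> _; rewrite exprD -exprM.
Qed.

(** Coprimality is to [q ^ k], not to [q]: at [k = 0] the term [v = 0] survives and the sum is 1, as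
    the top level [m = t] requires. *)
Definition unit_sum (q k : nat) w : R :=
  \sum_(0 <= v < q ^ k | coprime v (q ^ k)) w ^+ v.

Lemma geom_unit_sum q k w : prime q ->
  geom w (q ^ k.+1) = unit_sum q k.+1 w + geom (w ^+ q) (q ^ k).
Proof.
move=> q_pr; have q_gt0 := prime_gt0 q_pr.
have -> : unit_sum q k.+1 w =
    (\sum_(0 <= a < q | a != 0%N) w ^+ a) * geom (w ^+ q) (q ^ k).
  rewrite -sum_mod_blocks -expnS; apply: eq_bigl => x.
  by rewrite coprime_pexpr // coprime_sym prime_coprime.
have := sum_mod_blocks w xpredT q (q ^ k); rewrite -expnS => blocks; rewrite {1}/geom blocks.
rewrite (bigID (fun a => a == 0%N)) /= mulrDl addrC; congr (_ + _).
rewrite -[q]prednK // big_ltn_cond //= big1_seq; last first.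
  by move=> a; rewrite mem_index_iota; case: a.
by rewrite addr0 mul1r.
Qed.

(** The exponents are sorted by their q-adic valuation [m]; the last index [m = k] holds the
    exponent 0 alone. *)
Lemma geom_sum_unit_sum q k w : prime q ->
  geom w (q ^ k) = \sum_(0 <= m < k.+1) unit_sum q (k - m) (w ^+ (q ^ m)).
Proof.
move=> q_pr; elim: k w => [|k IHk] w.
  by rewrite big_nat1 /unit_sum /geom subnn !expn0 expr1 !big_mkord !big_ord1_cond.
rewrite big_nat_recl //= subn0 expr1 geom_unit_sum // IHk; congr (_ + _).
by apply: eq_bigr => m _; rewrite subSS -exprM -expnS.
Qed.

(** With G the full geometric sum and T' the one over multiples of q, U = G - T'. The relations G^2
    = q^(k+1) G, T' G = q^k G and T'^2 = q^k T' give U^2 = (q - 2) q^k G + q^k T', and G = U + T'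
    ends the computation. *)
Lemma unit_sum_sqr q k w : prime q -> w ^+ (q ^ k.+1) = 1 ->
  unit_sum q k.+1 w ^+ 2 = unit_sum q k.+1 w *+ ((q - 2) * q ^ k)
    + (\sum_(0 <= m < k.+1) unit_sum q (k - m) (w ^+ (q ^ m.+1)))
      *+ totient (q ^ k.+1).
Proof.
move=> q_pr wq1; have q_gt1 := prime_gt1 q_pr.
under [X in _ + X *+ _]eq_bigr do rewrite expnS exprM.
rewrite -geom_sum_unit_sum // totient_pfactor //=.
set T' := geom (w ^+ q) _.
have T'2 : T' ^+ 2 = T' *+ q ^ k by rewrite geom_sqr // -exprM -expnS.
have T2 := geom_sqr _ _ wq1.
have TT' : T' * geom w (q ^ k.+1) = geom w (q ^ k.+1) *+ q ^ k.
  rewrite {1}/T' /geom; under eq_bigr do rewrite -exprM.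
  rewrite big_distrl /=; under eq_bigr do rewrite mul_geom //.
  by rewrite sumr_const_nat subn0.
move: TT' T2; rewrite geom_unit_sum // -/T'; set U := unit_sum _ _ _.
have -> : U ^+ 2 = (U + T') ^+ 2 - (T' * (U + T')) *+ 2 + T' ^+ 2 by ring.
move=> -> ->; rewrite T'2 expnS.
(* Writing [q] as [c.+2] removes the truncated subtractions [q - 2] and [q.-1], which [ring] cannot
   treat. *)
move: U T' T'2 => U T' _; have [c ->] : exists c, q = c.+2 by exists (q - 2)%N; lia.
by rewrite subn2 /=; ring.
Qed.

(** The preceding square, with the levels counted absolutely from [j] to [t] as in the final
    formula. *)
Lemma unit_sum_sqr_tower q t j a (y : R) : prime q -> (j < t)%N ->
  y ^+ (a * q ^ t) = 1 ->
  unit_sum q (t - j) (y ^+ (a * q ^ j)) ^+ 2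
    = unit_sum q (t - j) (y ^+ (a * q ^ j)) *+ ((q - 2) * q ^ (t - j - 1))
      + (\sum_(j.+1 <= m < t.+1) unit_sum q (t - m) (y ^+ (a * q ^ m)))
        *+ totient (q ^ (t - j)).
Proof.
move=> q_pr lt_jt yt; rewrite -[j.+1]add0n big_addn subSS.
under [X in _ + X *+ _]eq_bigr do
  rewrite addnC addSn -addnS expnD mulnA exprM subnDA.
set w := y ^+ _; have : w ^+ (q ^ (t - j)) = 1.
  by rewrite -exprM -mulnA -expnD subnKC // ltnW.
have : (0 < t - j)%N by rewrite subn_gt0.
case: (t - j)%N => // k _ wk; rewrite unit_sum_sqr // subn1.
by under [X in _ = _ + X *+ _]eq_bigr do rewrite subSS.
Qed.

End GeometricSums.

(** * Squares, nonsquares and sums of two of them in ['F_p], with -1 a nonsquare *)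

Lemma odd_half_pred p : (p = 3 %[mod 4])%N -> odd p.-1./2.
Proof. by lia. Qed.

Lemma half_pred_gt0 p : (p = 3 %[mod 4])%N -> (0 < p.-1./2)%N.
Proof. by lia. Qed.

Section QuadraticClasses.

Variable p : nat.
Hypotheses (p_pr : prime p) (p_mod4 : (p = 3 %[mod 4])%N).
Local Notation h := (p.-1./2).
Implicit Types (x y z e : 'F_p).

(** Fermat's little theorem, obtained from the Frobenius map fixing the prime field. *)
Lemma expf_half_sqr x : x != 0 -> (x ^+ h) ^+ 2 = 1.
Proof.
move=> x0; apply: (mulfI x0); rewrite -exprM -exprS mulr1.
have -> : (h * 2).+1 = p by lia.
by rewrite -[x in LHS]natr_Zp -(pFrobenius_autE (pchar_Fp p_pr))
  pFrobenius_aut_nat natr_Zp.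
Qed.

Lemma expf_half x : x != 0 -> x ^+ h = 1 \/ x ^+ h = -1.
Proof. by move/expf_half_sqr/eqP; rewrite sqrf_eq1 => /orP[]/eqP; [left | right]. Qed.

Lemma expf_half_opp x : (- x) ^+ h = - x ^+ h.
Proof. by rewrite exprNn -signr_odd odd_half_pred // mulN1r. Qed.

Lemma expf_half0 : (0 : 'F_p) ^+ h = 0.
Proof. by rewrite expr0n; case: h (half_pred_gt0 p p_mod4). Qed.

Lemma oppr1_neq1_Fp : (-1 : 'F_p) != 1.
Proof.
apply/eqP => E; have := @dvdn_pcharf _ p (pchar_Fp p_pr) 2.
rewrite -[2%N]/(1 + 1)%N natrD -{1}E addNr eqxx => /dvdn_leq; lia.
Qed.

Lemma expf_half_eq0 x : (x ^+ h == 0) = (x == 0).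
Proof. by rewrite expf_eq0 half_pred_gt0. Qed.

(** Ordered representations of [z] as a sum of two elements of the class [e]: the coefficients met
    on squaring a class sum. *)
Definition rep_count e z := #|[set x : 'F_p | (x ^+ h == e) && ((z - x) ^+ h == e)]|.

(** As -1 is a nonsquare, [x] and [- x] never share a class. *)
Lemma rep_count0 e : e != 0 -> rep_count e 0 = 0%N.
Proof.
move=> e0; apply: eq_card0 => x; rewrite !inE sub0r expf_half_opp.
apply/negP => /andP[/eqP-> /eqP]. 
move/eqP; rewrite -subr_eq0 -opprD oppr_eq0 -mulr2n -mulr_natr mulf_eq0 (negPf e0) /=.
rewrite -[2%:R]/(1 + 1 : 'F_p) addr_eq0 eq_sym; exact/negP/oppr1_neq1_Fp.
Qed.

(** Dividing a representation of [z] by [z] multiplies the class by [z ^+ h], which is its own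
    inverse. *)
Lemma rep_count_scale e z : z != 0 -> rep_count e z = rep_count (e * z ^+ h) 1.
Proof.
move=> z0; have zVh : z^-1 ^+ h = z ^+ h.
  rewrite exprVn; apply: (@mulfI _ (z ^+ h)); first by rewrite expf_half_eq0.
  by rewrite mulfV ?expf_half_eq0 // -expr2 expf_half_sqr.
rewrite /rep_count -(card_imset _ (mulfI (invr_neq0 z0))).
apply: eq_card => y; rewrite inE; apply/imsetP/idP => [[x] | ].
  rewrite inE => /andP[/eqP xe /eqP zxe] ->.
  have -> : 1 - z^-1 * x = z^-1 * (z - x) by rewrite mulrBr mulVf.
  by rewrite !exprMn xe zxe zVh mulrC eqxx.
move=> /andP[/eqP ye /eqP zye]; exists (z * y); last by rewrite mulKf.
rewrite inE; have -> : z - z * y = z * (1 - y) by rewrite mulrBr mulr1.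
by rewrite !exprMn ye zye mulrCA -expr2 expf_half_sqr // mulr1 eqxx.
Qed.

(** Up to the sign of [x], these are the cyclotomic numbers of order two. *)
Definition cross_count e f :=
  #|[set x : 'F_p | (x ^+ h == e) && ((1 - x) ^+ h == f)]|.

Lemma sum_half_bool x : x != 0 -> ((x ^+ h == 1)%R + (x ^+ h == -1)%R = 1)%N.
Proof.
have := oppr1_neq1_Fp; rewrite eq_sym => /negPf n1.
by move=> /expf_half[->|->]; rewrite eqxx ?[-1 == 1]eq_sym n1.
Qed.

Lemma sum_bool_card (T : finType) (A B : pred T) :
  (\sum_(x | A x) B x = #|[set x | A x && B x]|)%N.
Proof. by rewrite -sum1dep_card big_mkcondr. Qed.

(** The class is sorted by the class of [1 - x]. Only [x = 1] has [1 - x] in neither class, and it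
    is counted by the Boolean term. *)
Lemma card_class_cross e :
  #|[set x : 'F_p | x ^+ h == e]|
    = ((e == 1%R) + (cross_count e 1%R + cross_count e (-1)%R))%N.
Proof.
have -> : nat_of_bool (e == 1) = #|[set x : 'F_p | (x ^+ h == e) && (x == 1)]|.
  case: eqP => [->|ne]; last first.
    by apply/esym/eq_card0 => x; rewrite !inE; apply/negP => /andP[/eqP xe /eqP x1];
      case: ne; rewrite -xe x1 expr1n.
  rewrite (_ : finset _ = [set 1]) ?cards1 //; apply/setP => x; rewrite !inE andbC.
  by case: eqP => //= ->; rewrite expr1n eqxx.
rewrite /cross_count -!sum_bool_card -!big_split /= -sum1dep_card.
apply: eq_bigr => x _; case: (eqVneq x 1) => [->|x1].
  rewrite subrr expf_half0 eq_sym oner_eq0 -[0 == -1]eq_sym oppr_eq0 oner_eq0 //.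
by rewrite sum_half_bool // subr_eq0 eq_sym.
Qed.

Lemma cross_count_swap e f : cross_count e f = cross_count f e.
Proof.
rewrite /cross_count -(card_imset _ (@subrI _ 1)).
apply: eq_card => y; rewrite inE; apply/imsetP/idP => [[x] | yP].
  by rewrite inE => /andP[xe xf] ->; rewrite subKr xe xf.
by exists (1 - y); rewrite ?inE subKr // andbC.
Qed.

(* By x |-> 1 / x, since 1 - 1 / x = - (1 - x) / x and -1 is not a square. *)
Lemma cross_count_inv : cross_count 1 (-1) = cross_count 1 1.
Proof.
rewrite /cross_count -(card_imset _ (@invr_inj _)).
apply: eq_card => y; rewrite inE.
have invP x : x ^+ h = 1 -> (1 - x^-1) ^+ h = - (1 - x) ^+ h.
  move=> x1; have x0 : x != 0 by rewrite -expf_half_eq0 x1 oner_eq0.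
  have -> : 1 - x^-1 = - (1 - x) * x^-1 by rewrite opprB mulrBl mulfV // mul1r.
  by rewrite exprMn exprVn x1 invr1 mulr1 expf_half_opp.
apply/imsetP/idP => [[x] | /andP[/eqP y1 y1']].
  rewrite inE => /andP[/eqP x1 /eqP x1'] ->.
  by rewrite exprVn invP // x1 x1' invr1 opprK eqxx.
by exists y^-1; rewrite ?invrK // inE exprVn invP // y1 (eqP y1') invr1 !eqxx.
Qed.

(** Negation exchanges the two classes, and together with 0 they exhaust ['F_p]. *)
Lemma card_class e : e = 1 \/ e = -1 -> #|[set x : 'F_p | x ^+ h == e]| = h.
Proof.
have opp : #|[set x : 'F_p | x ^+ h == -1]| = #|[set x : 'F_p | x ^+ h == 1]|.
  rewrite -(card_imset _ (@oppr_inj 'F_p)); apply: eq_card => y; rewrite inE.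
  apply/imsetP/idP => [[x] | y1].
    by rewrite inE => /eqP x1 ->; rewrite expf_half_opp x1 opprK.
  by exists (- y); rewrite ?opprK // inE expf_half_opp (eqP y1).
have tot : #|'F_p| = (1 + (#|[set x : 'F_p | x ^+ h == 1]%R| + #|[set x : 'F_p | x ^+ h == -1]%R|))%N.
  rewrite -[LHS]sum1_card (bigD1 0) //=; congr (_ + _)%N.
  rewrite (eq_bigr (fun x => (x ^+ h == 1)%R + (x ^+ h == -1)%R)%N); last first.
    by move=> x /sum_half_bool.
  rewrite big_split /= !sum_bool_card; congr (_ + _)%N; apply: eq_card => x;
  rewrite !inE; case: (eqVneq x 0) => //= ->; rewrite expf_half0.
    by rewrite eq_sym oner_eq0.
  by rewrite eq_sym oppr_eq0 oner_eq0.
rewrite card_Fp // opp in tot.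
by case=> ->; rewrite ?opp; lia.
Qed.

(** Scaling reduces the count to N = [cross_count 1 1]. The class of 1 splits as h = 1 + 2N, so N =
    (p - 3)/4. *)
Lemma rep_count_same e z : e = 1 \/ e = -1 -> z ^+ h = e ->
  rep_count e z = ((p - 3) %/ 4)%N.
Proof.
move=> e1 ze; have e0 : e != 0 by case: e1 => ->; rewrite ?oppr_eq0 oner_eq0.
rewrite rep_count_scale -1?expf_half_eq0 ze //.
have -> : e * e = 1 by case: e1 => ->; ring.
have := card_class_cross 1; rewrite card_class ?eqxx; last by left.
by rewrite cross_count_inv /rep_count -/(cross_count 1 1) /=; lia.
Qed.

(** Scaling reduces the count to [cross_count (-1) (-1)]. The class of -1 has h elements, of which N
    = (p - 3)/4 have [1 - x] in the class of 1; this leaves h - N = (p + 1)/4. *)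
Lemma rep_count_opp e z : e = 1 \/ e = -1 -> z ^+ h = - e ->
  rep_count e z = ((p + 1) %/ 4)%N.
Proof.
move=> e1 ze; have e0 : e != 0 by case: e1 => ->; rewrite ?oppr_eq0 oner_eq0.
rewrite rep_count_scale -1?expf_half_eq0 ze ?oppr_eq0 //.
have -> : e * - e = -1 by case: e1 => ->; ring.
have := card_class_cross 1; rewrite card_class ?eqxx; last by left.
have := card_class_cross (-1); rewrite card_class; last by right.
rewrite (negPf oppr1_neq1_Fp) [cross_count (-1) 1]cross_count_swap cross_count_inv.
by rewrite /rep_count -/(cross_count (-1) (-1)) /=; lia.
Qed.

Definition class_sum (R : comNzRingType) e (k : nat) (w : R) : R :=
  \sum_(0 <= u < p ^ k | (u%:R : 'F_p) ^+ h == e) w ^+ u.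

Lemma class_sum_blocks (R : comNzRingType) e k (w : R) :
  class_sum R e k.+1 w
    = (\sum_(x : 'F_p | x ^+ h == e) w ^+ (x : nat)) * geom R (w ^+ p) (p ^ k).
Proof.
rewrite /class_sum expnS.
under eq_bigl => u do rewrite -Fp_nat_mod //.
rewrite (sum_mod_blocks _ _ (fun u => (u%:R : 'F_p) ^+ h == e)); congr (_ * _).
rewrite -[p in \sum_(0 <= _ < p | _) _](Fp_cast p_pr) big_mkord.
by apply: eq_bigl => x; rewrite natr_Zp.
Qed.

(** The sum is A T, with A over the class in ['F_p] and T geometric in [w ^+ p]. One factor T of the
    square only contributes [p ^ k]; the other makes the exponents in A^2 count modulo p, so that
    A^2 T is governed by [rep_count]. *)
Lemma class_sum_sqr (R : comNzRingType) e k (w : R) :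
  e = 1 \/ e = -1 -> w ^+ (p ^ k.+1) = 1 ->
  class_sum R e k.+1 w ^+ 2 = class_sum R e k.+1 w *+ ((p - 3) %/ 4 * p ^ k)
    + class_sum R (- e) k.+1 w *+ ((p + 1) %/ 4 * p ^ k).
Proof.
move=> e1 wpk1; rewrite !class_sum_blocks; set T := geom _ _ _.
(* T absorbs powers of [w ^+ p], so beside T the exponent of [w] may be read in ['F_p]. *)
have wpT a : w ^+ (a %% p) * T = w ^+ a * T.
  rewrite {2}(divn_eq a p) addnC exprD -mulrA [(_ * p)%N]mulnC exprM.
  by rewrite [_ * T in RHS]mul_geom // -exprM -expnS.
have T2 : T ^+ 2 = T *+ p ^ k by rewrite geom_sqr // -exprM -expnS.
pose f z := w ^+ (z : nat) * T.
have fM x y : w ^+ (x : nat) * f y = f (x + y).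
  rewrite /f mulrA -exprD -wpT; congr (w ^+ _ * T).
  exact: (congr1 (modn _) (esym (Fp_cast p_pr))).
have e0 : e != 0 by case: e1 => ->; rewrite ?oppr_eq0 oner_eq0.
have sqrT : (\sum_(x : 'F_p | x ^+ h == e) w ^+ (x : nat)) ^+ 2 * T
  = \sum_z f z *+ rep_count e z.
  rewrite expr2 -mulrA; set A := (X in _ * (X * T)); rewrite mulr_suml /A.
  (* The substitution z = x + y, followed by an exchange of sums, collects the representations of
     each z. *)
  rewrite big_distrl /= (eq_bigr (fun x => \sum_(z | (z - x) ^+ h == e) f z)).
    rewrite (exchange_big_dep xpredT) //=; apply: eq_bigr => z _.
    by rewrite sumr_const /rep_count; congr (_ *+ _); apply: eq_card => x; rewrite inE.
  move=> x _; rewrite mulr_sumr [RHS](reindex_inj (addrI x)) /=.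
  by apply: eq_big => y; [rewrite [x + y]addrC addrK | rewrite fM].
rewrite exprMn T2 mulrnAr sqrT !mulrnA -mulrnDl; congr (_ *+ _).
(* The term z = 0 vanishes; the nonzero z split into the classes [e] and [- e], with a constant
   count on each. *)
rewrite !mulr_suml -!sumrMnl [LHS](bigD1 0) //= rep_count0 // mulr0n add0r.
rewrite (bigID (fun z : 'F_p => z ^+ h == e)) /=; congr (_ + _).
  apply: eq_big => z; last by move=> /andP[_ /eqP ze]; rewrite rep_count_same.
  by rewrite -expf_half_eq0; case: (z ^+ h =P e) => [->|]; rewrite ?e0 ?andbF.
have classN z : (z != 0) && (z ^+ h != e) = (z ^+ h == - e).
  case: (eqVneq z 0) => [->|/expf_half z1] /=.
    by rewrite expf_half0 eq_sym oppr_eq0 (negPf e0).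
  have/negPf n1 := oppr1_neq1_Fp; have n1' : (1 == -1 :> 'F_p) = false by rewrite eq_sym.
  by case: e1 z1 => -> [] ->; rewrite ?opprK ?eqxx ?n1 ?n1'.
by apply: eq_big => // z; rewrite classN => /eqP zN; rewrite rep_count_opp.
Qed.

End QuadraticClasses.

(** * Congruences and multiplicative orders *)

Lemma eq_mod_dvd d m a b : (d %| m)%N -> a = b %[mod m] -> a = b %[mod d].
Proof. by move=> dm ab; rewrite -(modn_dvdm a dm) ab modn_dvdm. Qed.

Lemma eqn_modMl k d a b : (0 < k)%N ->
  (k * a == k * b %[mod k * d])%N = (a == b %[mod d])%N.
Proof. by move=> k_gt0; rewrite -!muln_modr eqn_pmul2l. Qed.

Lemma eqn_mod_coprimeMl k d a b : coprime k d ->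
  (k * a == k * b %[mod d])%N = (a == b %[mod d])%N.
Proof.
move=> kd; wlog ab : a b / (a <= b)%N => [wlog_ab | ].
  by case/orP: (leq_total a b) => /wlog_ab // E; rewrite eq_sym E eq_sym.
rewrite eq_sym [RHS]eq_sym !eqn_mod_dvd ?leq_mul //.
by rewrite -mulnBr Gauss_dvdr // coprime_sym.
Qed.

(** A number congruent to 0 modulo [a] and to [b] modulo [d] is a multiple of [a], and the quotient
    is a solution. *)
Lemma coprime_solve a b d : coprime a d -> exists x, (a * x = b %[mod d])%N.
Proof.
move=> ad; pose z := chinese a d 0 b.
have az : (a %| z)%N by rewrite /dvdn chinese_modl // mod0n.
by exists (z %/ a)%N; rewrite mulnC divnK // chinese_modr.
Qed.

Lemma eq_mod_coprime d a b : a = b %[mod d] -> coprime a d = coprime b d.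
Proof. by move=> ab; rewrite -coprime_modl ab coprime_modl. Qed.

Lemma eqFp p a b : prime p ->
  (a%:R == b%:R :> 'F_p) = (a == b %[mod p])%N.
Proof. by move=> p_pr; rewrite -val_eqE /= !val_Fp_nat. Qed.

Lemma eqZp m a b : (1 < m)%N -> (a%:R == b%:R :> 'Z_m) = (a == b %[mod m])%N.
Proof. by move=> m_gt1; rewrite -val_eqE /= !val_Zp_nat. Qed.

(** A positive value rules out the default 0, which gives access to the group of units. *)
Lemma ord_mod_unit m k : (0 < ord_mod m k%:Z)%N ->
  exists2 u : {unit 'Z_m}, val u = k%:R & #[u]%g = ord_mod m k%:Z.
Proof.
rewrite /ord_mod; case: insubP => [u _ uk _|]; last by [].
by exists u; rewrite // uk pmulrn.
Qed.

Lemma expg_unitE m (u : {unit 'Z_m}) (k r : nat) :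
  val u = k%:R -> val (u ^+ r)%g = (k ^ r)%:R.
Proof. by move=> uk; rewrite FinRing.val_unitX uk natrX. Qed.

Lemma exp_ord_mod m k : (1 < m)%N -> (0 < ord_mod m k%:Z)%N ->
  (k ^ ord_mod m k%:Z = 1 %[mod m])%N.
Proof.
move=> m_gt1 /ord_mod_unit[u uk <-]; apply/eqP; rewrite -eqZp //.
by rewrite -(expg_unitE m u) // expg_order.
Qed.

Lemma ord_mod_coprime m k : (1 < m)%N -> (0 < ord_mod m k%:Z)%N -> coprime k m.
Proof.
move=> m_gt1 /ord_mod_unit[u uk _].
by rewrite coprime_sym -unitZpE // -[_%:R]uk (valP u).
Qed.

Lemma primitive_root_cycle m (u : {unit 'Z_m}) : (1 < m)%N ->
  #[u]%g = totient m -> <[u]>%g = [set: {unit 'Z_m}].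
Proof.
move=> m_gt1 um; apply/eqP; rewrite eqEcard subsetT /=.
rewrite -orderE um -card_units_Zp ?(ltnW m_gt1) //.
Qed.

Lemma unit_of_coprime m x : (1 < m)%N -> coprime x m ->
  exists u : {unit 'Z_m}, val u = x%:R.
Proof.
move=> m_gt1 xm; have ux : (x%:R : 'Z_m) \is a GRing.unit.
  by rewrite unitZpE // coprime_sym.
by exists (FinRing.unit _ ux).
Qed.

Lemma primitive_root_power m k x : (1 < m)%N ->
  ord_mod m k%:Z = totient m -> coprime x m -> exists r, (k ^ r = x %[mod m])%N.
Proof.
move=> m_gt1 km xm; have [u uk um] : exists2 u : {unit 'Z_m}, val u = k%:R & #[u]%g = totient m.
  by rewrite -km; apply: ord_mod_unit; rewrite km totient_gt0 ltnW.
have [v vx] := unit_of_coprime m x m_gt1 xm.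
have /cycleP[r vr] : v \in <[u]>%g by rewrite primitive_root_cycle // inE.
by exists r; apply/eqP; rewrite -eqZp // -(expg_unitE m u) // -vr vx.
Qed.

(** * The quadratic character modulo p and the powers of [g] and [l] *)

Section QuadraticCharacter.

Variables (p s : nat).
Hypotheses (p_pr : prime p) (p_mod4 : (p = 3 %[mod 4])%N) (s_gt0 : (0 < s)%N).
Local Notation h := (p.-1./2).

(** The Legendre symbol by Euler's criterion, kept in ['F_p] so that its values are the class
    labels. *)
Definition quad_char (x : nat) : 'F_p := x%:R ^+ h.

Lemma quad_charM x y : quad_char (x * y) = quad_char x * quad_char y.
Proof. by rewrite /quad_char natrM exprMn. Qed.

Lemma quad_charX x r : quad_char (x ^ r) = quad_char x ^+ r.
Proof. by rewrite /quad_char natrX exprAC. Qed.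

Lemma quad_char_mod k x y : (0 < k)%N ->
  x = y %[mod p ^ k] -> quad_char x = quad_char y.
Proof.
move=> k_gt0 /(eq_mod_dvd p) xy; congr (_ ^+ h); apply/eqP.
by rewrite eqFp //; apply/eqP/xy; rewrite dvdn_exp.
Qed.

Lemma natr_Fp_neq0 x : coprime x p -> x%:R != 0 :> 'F_p.
Proof.
by move=> xp; rewrite -unitfE unitFpE // coprime_sym.
Qed.

Lemma quad_char_pm x : coprime x p -> quad_char x = 1 \/ quad_char x = -1.
Proof. by move/natr_Fp_neq0; exact: expf_half. Qed.

Lemma quad_char_sqr x : coprime x p -> quad_char x ^+ 2 = 1.
Proof. by case/quad_char_pm => ->; rewrite ?sqrrN expr1n. Qed.

Lemma quad_char_coprime x : quad_char x != 0 -> coprime x p.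
Proof.
rewrite expf_half_eq0 // => x0.
by rewrite coprime_sym -unitFpE // unitfE.
Qed.

Lemma quad_char_pred : quad_char (p ^ s).-1 = -1.
Proof.
rewrite /quad_char -subn1 natrB ?expn_gt0 ?prime_gt0 // natrX pchar_Fp_0 //.
by rewrite expr0n -leqn0 leqNgt s_gt0 sub0r expf_half_opp // expr1n.
Qed.

Lemma quad_char_residue x : quadratic_residue p x -> quad_char x = 1.
Proof.
case=> xp [y /eqP]; rewrite -(eqFp p _ _ p_pr) => /eqP yx.
have /quad_char_sqr : coprime y p; last first.
  by rewrite -quad_charX /quad_char yx.
by rewrite coprime_sym -unitFpE // -(unitrX_pos _ (isT : 0 < 2)%N) -natrX yx unitFpE // coprime_sym.
Qed.

(* Since h is odd, a root of X ^ h = 1 is the square of its power (h + 1) / 2. *)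
Lemma quad_char_nonresidue x : quadratic_nonresidue p x -> quad_char x = -1.
Proof.
case=> xp nx; case: (quad_char_pm x xp) => // x1; case: nx.
exists (x ^ h.+1./2)%N; apply/eqP; rewrite -eqFp // natrX natrX -exprM.
have -> : (h.+1./2 * 2 = h.+1)%N by rewrite muln2 even_halfK //= negbK odd_half_pred.
by rewrite exprS -/(quad_char x) x1 mulr1.
Qed.

(** Were the character 1 at [g], it would be 1 at every power of [g], hence at [(p ^ s).-1], where
    it is -1. *)
Lemma quad_char_primitive g : ord_mod (p ^ s) g%:Z = totient (p ^ s) ->
  quad_char g = -1.
Proof.
move=> g_ord; have p_gt1 := prime_gt1 p_pr.
have ps_gt1 : (1 < p ^ s)%N by rewrite -(exp1n s) ltn_exp2r.
have gp : coprime g p.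
  by rewrite -(coprime_pexpr _ _ s_gt0) ord_mod_coprime // g_ord totient_gt0 ltnW.
case: (quad_char_pm g gp) => // g1.
have [|r gr] := primitive_root_power _ _ (p ^ s).-1 ps_gt1 g_ord.
  by rewrite coprimePn // ltnW.
have := quad_char_mod s _ _ s_gt0 gr.
by rewrite quad_charX g1 expr1n quad_char_pred => <-.
Qed.

Lemma totient_half : (totient (p ^ s) %/ 2 = p ^ s.-1 * h)%N.
Proof.
rewrite -[s in LHS]prednK // totient_pfactor //.
by rewrite mulnC -muln_divA /= -?divn2 //; lia.
Qed.

(** The order [p ^ s.-1 * h] is odd, and a sign with an odd power equal to 1 is 1. *)
Lemma quad_char_half_ord l : ord_mod (p ^ s) l%:Z = (totient (p ^ s) %/ 2)%N ->
  quad_char l = 1.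
Proof.
move=> l_ord; have p_gt1 := prime_gt1 p_pr.
have ps_gt1 : (1 < p ^ s)%N by rewrite -(exp1n s) ltn_exp2r.
have l_gt0 : (0 < ord_mod (p ^ s) l%:Z)%N.
  by rewrite l_ord totient_half muln_gt0 expn_gt0 prime_gt0 // half_pred_gt0.
have lp : coprime l p by rewrite -(coprime_pexpr _ _ s_gt0) ord_mod_coprime.
have := exp_ord_mod _ _ ps_gt1 l_gt0; rewrite l_ord totient_half.
move/(quad_char_mod s _ _ s_gt0); rewrite quad_charX {2}/quad_char expr1n.
have odd_e : odd (p ^ s.-1 * h).
  by rewrite oddM oddX odd_half_pred // andbT; apply/orP; right; lia.
by case: (quad_char_pm l lp) => -> //; rewrite -signr_odd odd_e.
Qed.

(* l is an even power of g, and <[l]>, <[g ^ 2]> both have order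
   totient (p ^ s) / 2, so they coincide. *)
Lemma half_ord_power g l x : ord_mod (p ^ s) g%:Z = totient (p ^ s) ->
  ord_mod (p ^ s) l%:Z = (totient (p ^ s) %/ 2)%N -> quad_char x = 1 ->
  exists r, (l ^ r = x %[mod p ^ s])%N.
Proof.
move=> g_ord l_ord x1; have p_gt1 := prime_gt1 p_pr.
have ps_gt1 : (1 < p ^ s)%N by rewrite -(exp1n s) ltn_exp2r.
have l1 := quad_char_half_ord l l_ord; have gN := quad_char_primitive g g_ord.
have [u ug u_ord] : exists2 u : {unit 'Z_(p ^ s)}, val u = g%:R & #[u]%g = totient (p ^ s).
  by rewrite -g_ord; apply: ord_mod_unit; rewrite g_ord totient_gt0 ltnW.
have [v vl v_ord] : exists2 v : {unit 'Z_(p ^ s)}, val v = l%:R & #[v]%g = (totient (p ^ s) %/ 2)%N.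
  rewrite -l_ord; apply: ord_mod_unit.
  by rewrite l_ord totient_half muln_gt0 expn_gt0 prime_gt0 // half_pred_gt0.
have sqr_u y (w : {unit 'Z_(p ^ s)}) : val w = y%:R -> quad_char y = 1 -> w \in <[u ^+ 2]>%g.
  move=> wy y1; have /cycleP[r wr] : w \in <[u]>%g by rewrite primitive_root_cycle // inE.
  have : quad_char y = quad_char (g ^ r).
    apply: (quad_char_mod s) => //; apply/eqP.
    by rewrite -eqZp // -(expg_unitE _ u) // -wr wy.
  rewrite y1 quad_charX gN -signr_odd => /esym/eqP.
  case: (boolP (odd r)) => odd_r; first by rewrite expr1 (negPf (oppr1_neq1_Fp _ p_pr p_mod4)).
  by rewrite wr -(even_halfK odd_r) -muln2 mulnC expgM mem_cycle.
have p_odd : (2 %| totient (p ^ s))%N.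
  by rewrite -(prednK s_gt0) totient_pfactor //= dvdn_mulr // dvdn2; lia.
have vu : <[v]>%g = <[u ^+ 2]>%g.
  apply/eqP; rewrite eqEcard cycle_subG (sqr_u l) //= -!orderE v_ord.
  by rewrite orderXdiv u_ord.
have xp : coprime x (p ^ s).
  by rewrite coprime_pexpr // quad_char_coprime // x1 oner_eq0.
have [w wx] := unit_of_coprime _ x ps_gt1 xp.
have /cycleP[r wr] : w \in <[v]>%g by rewrite vu (sqr_u x).
by exists r; apply/eqP; rewrite -eqZp // -(expg_unitE _ v) // -wr wx.
Qed.

End QuadraticCharacter.

(** * Cyclotomic cosets in Chinese remainder coordinates *)

Section Cosets.

Variables (p q s t l : nat).
Hypotheses (p_pr : prime p) (q_pr : prime q) (p_mod4 : (p = 3 %[mod 4])%N).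
Hypotheses (neq_pq : p <> q) (s_gt0 : (0 < s)%N) (t_gt0 : (0 < t)%N).
Hypothesis lq : coprime l q.
Hypothesis l_char : quad_char p l = 1.
Hypothesis l_power : forall x1 x2, quad_char p x1 = 1 -> coprime x2 q ->
  exists r, (l ^ r = x1 %[mod p ^ s])%N /\ (l ^ r = x2 %[mod q ^ t])%N.

Local Notation n := (p ^ s * q ^ t)%N.

Lemma coprime_pq : coprime p q.
Proof. by rewrite prime_coprime // dvdn_prime2 //; apply/eqP. Qed.

Lemma modulus_gt1 : (1 < n)%N.
Proof.
have p1 := prime_gt1 p_pr; have q1 := prime_gt1 q_pr.
have ps : (1 < p ^ s)%N by rewrite -(exp1n s) ltn_exp2r.
have qt : (1 < q ^ t)%N by rewrite -(exp1n t) ltn_exp2r.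
by rewrite (leq_trans ps) // leq_pmulr // ltnW.
Qed.

Lemma mem_coset_nat m (a : 'Z_n) :
  a \in cyclotomic_coset n l m%:Z <-> exists r, a = (m * l ^ r)%:R.
Proof.
by rewrite mem_cyclotomic_coset; split=> -[r ->]; exists r;
  rewrite pmulrn PoszM -rmorphXn.
Qed.

Lemma crt_eqmod a b x :
  (q ^ t * a + p ^ s * b == x %[mod n])%N
    = (q ^ t * a == x %[mod p ^ s])%N && (p ^ s * b == x %[mod q ^ t])%N.
Proof.
rewrite chinese_remainder; last by rewrite coprimeXl ?coprimeXr ?coprime_pq.
rewrite [(p ^ s * b)%N in X in X && _]mulnC [(q ^ t * a + _)%N in X in X && _]addnC.
by rewrite modnMDl [(q ^ t * a)%N in X in _ && X]mulnC modnMDl.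
Qed.

Lemma eqmod_pblock i a b : (i <= s)%N ->
  (p ^ i * a == p ^ i * b %[mod p ^ s])%N = (a == b %[mod p ^ (s - i)])%N.
Proof.
by move=> le_is; rewrite -{1 2}(subnKC le_is) expnD eqn_modMl ?expn_gt0 ?prime_gt0.
Qed.

Lemma eqmod_qblock j a b : (j <= t)%N ->
  (q ^ j * a == q ^ j * b %[mod q ^ t])%N = (a == b %[mod q ^ (t - j)])%N.
Proof.
by move=> le_jt; rewrite -{1 2}(subnKC le_jt) expnD eqn_modMl ?expn_gt0 ?prime_gt0.
Qed.

(** Modulo each prime power one summand vanishes, and [p ^ i] or [q ^ j] cancels at the price of a
    smaller modulus. *)
Lemma crt_blocks i j u v m : (i <= s)%N -> (j <= t)%N ->
  (q ^ t * (p ^ i * u) + p ^ s * (q ^ j * v) == p ^ i * q ^ j * m %[mod n])%N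
    = (q ^ t * u == q ^ j * m %[mod p ^ (s - i)])%N
      && (p ^ s * v == p ^ i * m %[mod q ^ (t - j)])%N.
Proof.
move=> le_is le_jt; rewrite crt_eqmod mulnCA -mulnA eqmod_pblock //.
by rewrite [(p ^ i * _)%N]mulnCA [(p ^ s * _)%N]mulnCA eqmod_qblock.
Qed.

(** An element with [m = c * l ^ r] satisfies q^t u = q^j c l^r modulo p^(s-i). As [l] has character
    1 and characters of units are signs, this fixes the character of u. Conversely, u and v
    prescribe the residues of [l ^ r], and [l_power] supplies a common exponent r. *)
Lemma coset_image i j c : (i < s)%N -> (j <= t)%N -> coprime c p -> coprime c q ->
  cyclotomic_coset n l (p ^ i * q ^ j * c)%N%:Z
   = [set (q ^ t * (p ^ i * w.1) + p ^ s * (q ^ j * w.2))%N%:R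
     | w : 'I_(p ^ (s - i)) * 'I_(q ^ (t - j)) &
       (quad_char p w.1 == quad_char p c * quad_char p q ^+ (t + j))
       && coprime w.2 (q ^ (t - j))].
Proof.
move=> lt_is le_jt cp cq; have n1 := modulus_gt1; have le_is := ltnW lt_is.
have si_gt0 : (0 < s - i)%N by rewrite subn_gt0.
have qp : coprime q p by rewrite coprime_sym coprime_pq.
have q_char2 := quad_char_sqr p p_pr p_mod4 q qp.
apply/setP => a; apply/idP/imsetP => [/mem_coset_nat[r ->] | [[u v]]].
  have [u0 u0P] : exists u, (q ^ t * u = q ^ j * (c * l ^ r) %[mod p ^ (s - i)])%N.
    by apply: coprime_solve; rewrite coprimeXl ?coprimeXr.
  have [v0 v0P] : exists v, (p ^ s * v = p ^ i * (c * l ^ r) %[mod q ^ (t - j)])%N.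
    by apply: coprime_solve; rewrite coprimeXl ?coprimeXr ?coprime_pq.
  have ltu : (u0 %% p ^ (s - i) < p ^ (s - i))%N by rewrite ltn_mod expn_gt0 prime_gt0.
  have ltv : (v0 %% q ^ (t - j) < q ^ (t - j))%N by rewrite ltn_mod expn_gt0 prime_gt0.
  exists (Ordinal ltu, Ordinal ltv); last first.
    by apply/eqP; rewrite eq_sym eqZp // -mulnA crt_blocks // !modnMmr u0P v0P !eqxx.
  rewrite inE /= coprime_modl; apply/andP; split.
    rewrite (quad_char_mod p p_pr (s - i) _ u0) ?modn_mod //.
    have := quad_char_mod p p_pr (s - i) _ _ si_gt0 u0P.
    rewrite !quad_charM !quad_charX l_char expr1n mulr1 => E.
    apply/eqP; rewrite exprD mulrCA [quad_char p c * _]mulrC -E mulrA -expr2 exprAC.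
    by rewrite q_char2 expr1n mul1r.
  have : coprime (p ^ s * v0) (q ^ (t - j)).
    rewrite (eq_mod_coprime _ _ _ v0P) coprimeXr // !coprimeMl cq.
    by rewrite !coprimeXl ?coprime_pq.
  by rewrite coprimeMl => /andP[].
rewrite inE /= => /andP[/eqP u_char vq] ->; apply/mem_coset_nat.
(* [x1] and [x2] are the residues wanted for [l ^ r] modulo [p ^ s] and [q ^ t]. *)
have [x1 x1P] : exists x, (q ^ j * c * x = q ^ t * u %[mod p ^ s])%N.
  by apply: coprime_solve; rewrite coprimeXr // coprimeMl cp coprimeXl.
have x1_char : quad_char p x1 = 1.
  have := quad_char_mod p p_pr s _ _ s_gt0 x1P.
  rewrite !quad_charM !quad_charX u_char exprD.
  (* Multiplying [E] by [e ^+ j * d] leaves only squares of signs beside the character of [x1]. *)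
  set e := quad_char p q; set d := quad_char p c => E.
  have d2 : d ^+ 2 = 1 by exact: quad_char_sqr.
  have : (e ^+ j) ^+ 2 * d ^+ 2 * quad_char p x1
     = (e ^+ t) ^+ 2 * (e ^+ j) ^+ 2 * d ^+ 2.
    transitivity (e ^+ j * d * (e ^+ j * d * quad_char p x1)); first by ring.
    by rewrite E; ring.
  by rewrite ![(e ^+ _) ^+ 2]exprAC q_char2 d2 !expr1n !mul1r.
have [x2 x2q x2P] : exists2 x, coprime x q &
    (p ^ i * c * x = p ^ s * v %[mod q ^ (t - j)])%N.
  (* At [j = t] the congruence is modulo 1 and says nothing about coprimality to [q], so the unit 1
     is chosen. *)
  case: (ltnP j t) => [lt_jt | ge_jt]; last first.
    exists 1%N; first exact: coprime1n.
    by apply: (eq_mod_dvd _ 1); rewrite ?modn1 // (eqP ge_jt).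
  have [x xP] : exists x, (p ^ i * c * x = p ^ s * v %[mod q ^ (t - j)])%N.
    by apply: coprime_solve; rewrite coprimeXr // coprimeMl cq coprimeXl // coprime_pq.
  exists x => //; have : coprime (p ^ i * c * x) (q ^ (t - j)).
    rewrite (eq_mod_coprime _ _ _ xP) coprimeMl vq andbT.
    by rewrite coprimeXl // coprimeXr // coprime_pq.
  by rewrite coprimeMl => /andP[_]; rewrite coprime_pexpr ?subn_gt0.
have [r [rp rq]] := l_power x1 x2 x1_char x2q; exists r.
apply/eqP; rewrite eqZp // -[(_ * _ * c * _)%N]mulnA crt_blocks //; apply/andP; split.
  rewrite mulnA eq_sym; apply/eqP; apply: (eq_mod_dvd _ (p ^ s)).
    by rewrite dvdn_exp2l ?leq_subr.
  by rewrite -modnMmr rp modnMmr.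
rewrite mulnA eq_sym; apply/eqP; rewrite -x2P -modnMmr.
by rewrite (eq_mod_dvd _ (q ^ t) _ _ _ rq) ?modnMmr // dvdn_exp2l ?leq_subr.
Qed.

(** The coordinates (u, v) are unique and their conditions independent, so the sum over the coset is
    a product. It serves [chi] with [c = 1] and [chi_star] with [c] representing [g]. *)
Lemma coset_sum_factor (R : comNzRingType) (y : R) i j c :
  (i < s)%N -> (j <= t)%N -> coprime c p -> coprime c q -> y ^+ n = 1 ->
  \sum_(a in cyclotomic_coset n l (p ^ i * q ^ j * c)%N%:Z) y ^+ (a : nat)
   = class_sum p R (quad_char p c * quad_char p q ^+ (t + j)) (s - i)
       (y ^+ (q ^ t * p ^ i))
     * unit_sum R q (t - j) (y ^+ (p ^ s * q ^ j)).
Proof.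
move=> lt_is le_jt cp cq yn; have n1 := modulus_gt1; have le_is := ltnW lt_is.
have qp : coprime q p by rewrite coprime_sym coprime_pq.
rewrite coset_image // big_imset /=; last first.
  move=> [u v] [u' v'] _ _ /= /eqP; rewrite eqZp // crt_eqmod.
  have dropP a b : (a + p ^ s * b = a %[mod p ^ s])%N by rewrite addnC mulnC modnMDl.
  have dropQ a b : (q ^ t * a + b = b %[mod q ^ t])%N by rewrite mulnC modnMDl.
  rewrite dropP dropQ (eqn_mod_coprimeMl (q ^ t)) ?(coprimeXl, coprimeXr) //.
  rewrite (eqn_mod_coprimeMl (p ^ s)) ?(coprimeXl, coprimeXr, coprime_pq) //.
  rewrite eqmod_pblock // eqmod_qblock //.
  by rewrite !modn_small // => /andP[/eqP/val_inj-> /eqP/val_inj->].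
rewrite /class_sum /unit_sum !big_mkord big_distrlr /= pair_big /=.
apply: eq_big => -[u v]; first by rewrite inE.
move=> _; rewrite val_Zp_nat //.
by rewrite expr_mod // !mulnA exprD !exprM.
Qed.

End Cosets.

(** * Reduction of exponents, the quotient ring, and the two product formulas *)

Lemma expn_eqmod m o k a b :
  (k ^ o = 1 %[mod m])%N -> (a = b %[mod o])%N -> (k ^ a = k ^ b %[mod m])%N.
Proof.
move=> ko ab; suff red c : (k ^ c = k ^ (c %% o) %[mod m])%N by rewrite red ab -red.
rewrite {1}(divn_eq c o) mulnC expnD expnM -modnMml -modnXm ko modnXm exp1n.
by rewrite modnMml mul1n.
Qed.

Lemma qX_Xn_sub1 n l : (0 < n)%N -> ('qX : cyclic_ring n l) ^+ n = 1.
Proof.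
move=> n_gt0; rewrite /qpolyX -rmorphXn -[X in _ = X](rmorph1 (in_qpoly _)).
apply/eqP; rewrite -subr_eq0 -rmorphB; apply/eqP/val_inj => /=.
by rewrite mk_monic_Xn_sub1 // Pdiv.RingMonic.rmodpp // monicXnsubC.
Qed.

(** One natural number replaces the integer [g] modulo [p ^ s], [q ^ t] and their product at
    once. *)
Lemma modz_representative (n : nat) (g : int) : (0 < n)%N ->
  exists g' : nat, forall m, (1 < m)%N -> (m %| n)%N -> g%:~R = g'%:Z%:~R :> 'Z_m.
Proof.
move=> n_gt0; exists `|(g %% n)%Z|%N => m m_gt1 mn.
rewrite {1}(divz_eq g n) gez0_abs; last by rewrite modz_ge0 // eqz_nat -lt0n.
have n0 : n%:R = 0 :> 'Z_m.
  by apply/eqP; rewrite -[0]/(0%:R) eqZp // mod0n.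
by rewrite rmorphD rmorphM /= [X in _ * X]n0 mulr0 add0r.
Qed.

Lemma ord_mod_intr m g g' : g%:~R = g'%:~R :> 'Z_m -> ord_mod m g = ord_mod m g'.
Proof. by rewrite /ord_mod => ->. Qed.

Lemma cyclotomic_coset_mulr n l (a : nat) g g' : g%:~R = g'%:Z%:~R :> 'Z_n ->
  cyclotomic_coset n l (a%:Z * g) = cyclotomic_coset n l (a * g')%N%:Z.
Proof. by move=> gg'; rewrite /cyclotomic_coset PoszM !intrM gg'. Qed.

Lemma sum_nat_if (V : nmodType) a b (P : pred nat) (F F1 F2 : nat -> V) :
  (forall m, (a <= m < b)%N -> F m = if P m then F2 m else F1 m) ->
  \sum_(a <= m < b) F m
    = \sum_(a <= m < b | ~~ P m) F1 m + \sum_(a <= m < b | P m) F2 m.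
Proof.
move=> FE; rewrite (eq_big_nat _ _ FE) (bigID P) /= [RHS]addrC.
by congr (_ + _); apply: eq_bigr => m; [move=> -> | move/negPf=> ->].
Qed.

Theorem theorem4p1 (s t p q l : nat) (g : int) (i j : nat)
    (s_ge1 : (1 <= s)%N) (t_ge1 : (1 <= t)%N)
    (p_prime : prime p) (q_prime : prime q) (l_prime : prime l)
    (neq_pq : p <> q) (neq_pl : p <> l) (neq_ql : q <> l)
    (p_odd : odd p) (q_odd : odd q) (p_mod4 : (p = 3 %[mod 4])%N)
    (ord_p : ord_mod (p ^ s) l%:Z = (totient (p ^ s) %/ 2)%N)
    (ord_q : ord_mod (q ^ t) l%:Z = totient (q ^ t))
    (gcd_pq : gcdn (totient (p ^ s)) (totient (q ^ t)) = 2%N)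
    (g_p : primitive_root_mod (p ^ s) g)
    (g_q : primitive_root_mod (q ^ t) g)
    (lt_is : (i <= s - 1)%N) (lt_jt : (j <= t - 1)%N) :
  let X := chi p q s t l in
  let X' := chi_star g p q s t l in
  let c (k : nat) : 'F_l := k%:R in
  (quadratic_residue p q ->
     X i j ^+ 2 =
       c ((p - 3) %/ 4 * p ^ (s - i - 1))%N *:
         (c ((q - 2) * q ^ (t - j - 1))%N *: X i j
          + c (totient (q ^ (t - j))) *: \sum_(j.+1 <= m < t.+1) X i m)
     + c ((p + 1) %/ 4 * p ^ (s - i - 1))%N *:
         (c ((q - 2) * q ^ (t - j - 1))%N *: X' i j
          + c (totient (q ^ (t - j))) *: \sum_(j.+1 <= m < t.+1) X' i m))
  /\
  (quadratic_nonresidue p q ->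
     X i j ^+ 2 =
       c ((p - 3) %/ 4 * p ^ (s - i - 1))%N *:
         (c ((q - 2) * q ^ (t - j - 1))%N *: X i j
          + c (totient (q ^ (t - j))) *:
              (\sum_(j.+1 <= m < t.+1 | ~~ (2 %| m - j)%N) X' i m
               + \sum_(j.+1 <= m < t.+1 | (2 %| m - j)%N) X i m))
     + c ((p + 1) %/ 4 * p ^ (s - i - 1))%N *:
         (c ((q - 2) * q ^ (t - j - 1))%N *: X' i j
          + c (totient (q ^ (t - j))) *:
              (\sum_(j.+1 <= m < t.+1 | ~~ (2 %| m - j)%N) X i m
               + \sum_(j.+1 <= m < t.+1 | (2 %| m - j)%N) X' i m))).
Proof.
move=> X X' c.
have p_gt0 := prime_gt0 p_prime; have q_gt0 := prime_gt0 q_prime.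
have ps_gt1 : (1 < p ^ s)%N by rewrite -(exp1n s) ltn_exp2r ?prime_gt1.
have qt_gt1 : (1 < q ^ t)%N by rewrite -(exp1n t) ltn_exp2r ?prime_gt1.
have n_gt1 := modulus_gt1 p q s t p_prime q_prime s_ge1 t_ge1.
have [g' gg'] := modz_representative _ g (ltnW n_gt1).
have g'_p : ord_mod (p ^ s) g'%:Z = totient (p ^ s).
  by rewrite -g_p; apply/esym/ord_mod_intr/gg'; rewrite ?dvdn_mulr.
have g'_q : ord_mod (q ^ t) g'%:Z = totient (q ^ t).
  by rewrite -g_q; apply/esym/ord_mod_intr/gg'; rewrite ?dvdn_mull.
have cop k r m : prime r -> (0 < m)%N -> (0 < ord_mod (r ^ m) k%:Z)%N -> coprime k r.
  move=> r_pr m_gt0 /ord_mod_coprime; rewrite coprime_pexpr //; apply.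
  by rewrite -(exp1n m) ltn_exp2r ?prime_gt1.
have g'p : coprime g' p by apply: (cop _ _ s); rewrite ?g'_p ?totient_gt0 ?expn_gt0 ?p_gt0.
have g'q : coprime g' q by apply: (cop _ _ t); rewrite ?g'_q ?totient_gt0 ?expn_gt0 ?q_gt0.
have lq : coprime l q by apply: (cop _ _ t); rewrite ?ord_q ?totient_gt0 ?expn_gt0 ?q_gt0.
have qp : coprime q p by rewrite coprime_sym coprime_pq.
have g'_char := quad_char_primitive p s p_prime p_mod4 s_ge1 g' g'_p.
have l_char := quad_char_half_ord p s p_prime p_mod4 s_ge1 l ord_p.
have half_tot := totient_half p s p_prime p_mod4 s_ge1.
have totient_even : (2 %| totient (p ^ s))%N.
  by rewrite -(prednK s_ge1) totient_pfactor //= dvdn_mulr // dvdn2; lia.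
(* The gcd divides 2 by [gcd_pq], and it is odd because [totient (p ^ s) %/ 2] is. *)
have ord_coprime : coprime (totient (p ^ s) %/ 2) (totient (q ^ t)).
  have o_odd : odd (totient (p ^ s) %/ 2).
    by rewrite half_tot oddM oddX p_odd orbT odd_half_pred.
  rewrite /coprime; set d := gcdn _ _.
  have d_odd : odd d by apply: dvdn_odd o_odd; exact: dvdn_gcdl.
  have : (d %| 2)%N.
    rewrite -gcd_pq dvdn_gcd dvdn_gcdr andbT (dvdn_trans (dvdn_gcdl _ _)) //.
    by rewrite -{2}(divnK totient_even) dvdn_mulr.
  by move/dvdn_leq => /(_ isT); case: d d_odd => [|[|[]]].
have l_power x1 x2 : quad_char p x1 = 1 -> coprime x2 q ->
    exists r, (l ^ r = x1 %[mod p ^ s])%N /\ (l ^ r = x2 %[mod q ^ t])%N.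
  move=> x1_char x2q.
  have [r1 <-] := half_ord_power p s p_prime p_mod4 s_ge1 g' l x1 g'_p ord_p x1_char.
  have [|r2 <-] := primitive_root_power _ _ x2 qt_gt1 ord_q.
    by rewrite coprime_pexpr.
  (* The moduli are the two orders of [l]; being coprime, they allow both exponents to be
     prescribed. *)
  exists (chinese (totient (p ^ s) %/ 2) (totient (q ^ t)) r1 r2); split.
    apply: (expn_eqmod _ (totient (p ^ s) %/ 2)); last exact: chinese_modl.
    rewrite -ord_p; apply: exp_ord_mod => //; rewrite ord_p half_tot.
    by rewrite muln_gt0 expn_gt0 p_gt0 half_pred_gt0.
  apply: (expn_eqmod _ (totient (q ^ t))); last exact: chinese_modr.
  by rewrite -ord_q; apply: exp_ord_mod => //; rewrite ord_q totient_gt0 ltnW.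
pose y : cyclic_ring (p ^ s * q ^ t) l := 'qX.
have yn : y ^+ (p ^ s * q ^ t) = 1 by rewrite qX_Xn_sub1 // ltnW.
have lt_is' : (i < s)%N by lia.
have lt_jt' : (j < t)%N by lia.
pose e := quad_char p q.
pose alpha a := class_sum p _ a (s - i) (y ^+ (q ^ t * p ^ i)).
pose beta m := unit_sum _ q (t - m) (y ^+ (p ^ s * q ^ m)).
have XE m : (m <= t)%N -> X i m = alpha (e ^+ (t + m)) * beta m.
  move=> le_mt; rewrite /X /chi /coset_sum -[(p ^ i * q ^ m)%N]muln1.
  rewrite (coset_sum_factor p q s t l) ?coprime1n //.
  by rewrite /quad_char expr1n mul1r.
have X'E m : (m <= t)%N -> X' i m = alpha (- e ^+ (t + m)) * beta m.
  move=> le_mt; rewrite /X' /chi_star /coset_sum.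
  rewrite (cyclotomic_coset_mulr _ _ _ _ g'); last exact: gg'.
  by rewrite (coset_sum_factor p q s t l) // g'_char mulN1r.
have e_pm := quad_char_pm p p_prime p_mod4 q qp; rewrite -/e in e_pm.
have etj_pm : e ^+ (t + j) = 1 \/ e ^+ (t + j) = -1.
  case: e_pm => ->; first by left; rewrite expr1n.
  by rewrite -signr_odd; case: odd; [right | left].
(* Both cases at once: squaring keeps the label of [alpha] at plus or minus [e ^+ (t + j)] on every
   level [m], whereas [X i m] carries [e ^+ (t + m)]. The cases differ only in comparing these
   labels. *)
have sqr : X i j ^+ 2 =
    c ((p - 3) %/ 4 * p ^ (s - i - 1))%N *:
      (c ((q - 2) * q ^ (t - j - 1))%N *: X i j + c (totient (q ^ (t - j))) *:
         \sum_(j.+1 <= m < t.+1) alpha (e ^+ (t + j)) * beta m)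
  + c ((p + 1) %/ 4 * p ^ (s - i - 1))%N *:
      (c ((q - 2) * q ^ (t - j - 1))%N *: X' i j + c (totient (q ^ (t - j))) *:
         \sum_(j.+1 <= m < t.+1) alpha (- e ^+ (t + j)) * beta m).
  rewrite XE ?X'E ?(ltnW lt_jt') // exprMn.
  have -> : alpha (e ^+ (t + j)) ^+ 2 =
      alpha (e ^+ (t + j)) *+ ((p - 3) %/ 4 * p ^ (s - i - 1))
      + alpha (- e ^+ (t + j)) *+ ((p + 1) %/ 4 * p ^ (s - i - 1)).
    rewrite /alpha; set w := y ^+ _; have : w ^+ (p ^ (s - i)) = 1.
      by rewrite -exprM -mulnA -expnD subnKC ?(ltnW lt_is') // -[RHS]yn; congr (y ^+ _); exact: mulnC.
    have : (0 < s - i)%N by rewrite subn_gt0.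
    by case: (s - i)%N => // k _ wk; rewrite class_sum_sqr // subn1.
  have -> : beta j ^+ 2 = beta j *+ ((q - 2) * q ^ (t - j - 1))
      + (\sum_(j.+1 <= m < t.+1) beta m) *+ totient (q ^ (t - j)).
    by rewrite /beta unit_sum_sqr_tower.
  rewrite /c !scaler_nat -!mulr_sumr !mulrnA.
  ring.
split=> [q_res | q_nres]; rewrite sqr.
  have e1 : e = 1 by exact: (quad_char_residue p p_prime p_mod4).
  congr (_ *: (_ + _ *: _) + _ *: (_ + _ *: _));
    by apply: eq_big_nat => m /andP[_ le_mt]; rewrite (XE, X'E) // e1 !expr1n.
have eN1 : e = -1 by exact: (quad_char_nonresidue p p_prime p_mod4).
(* With [e = -1] the labels at levels [j] and [m] differ by the sign (-1)^(m-j), which exchanges [X]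
   and [X'] when [m - j] is odd. *)
have eE m : (j < m <= t)%N ->
    e ^+ (t + j) = if (2 %| m - j)%N then e ^+ (t + m) else - e ^+ (t + m).
  move=> /andP[lt_jm _]; rewrite eN1 -(subnKC (ltnW lt_jm)) addnA addKn.
  rewrite [in RHS]exprD dvdn2; set a := (m - j)%N.
  by rewrite -[_ ^+ a]signr_odd; case: (odd a); rewrite /= ?expr1 ?expr0 ?mulrN1 ?mulr1 ?opprK.
congr (_ *: (_ + _ *: _) + _ *: (_ + _ *: _)); apply: sum_nat_if => m m_range;
  have /andP[_ le_mt] := m_range;
  by rewrite XE ?X'E // (eE m) //; case: ifP; rewrite ?opprK.
Qed.
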